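(* Let $m\ge 1$ be an integer, let $a_1,\dots,a_m$ and $b$ be complex numbers, and let $q,t,h_1,\dots,h_m$ be complex numbers with $|q^t|<1$, $|q^{h_r}|<1$ and $|q^{th_r}|<1$ for $r=1,\dots,m$. Suppose none of the denominators below vanish. Then for $|w|<1$ and $|z_r|<1$ ($r=1,\dots,m$), \[ \sum_{k_1,\dots,k_m\ge 0}\ \prod_{r=1}^m \frac{(a_r;q^{h_r})_{k_r}}{(q^{h_r};q^{h_r})_{k_r}}\, \frac{(w;q^t)_{h_1k_1+\cdots+h_mk_m}}{(bw;q^t)_{h_1k_1+\cdots+h_mk_m}}\prod_{r=1}^m z_r^{k_r} = \frac{(w;q^t)_\infty}{(bw;q^t)_\infty}\prod_{r=1}^m\frac{(a_rz_r;q^{h_r})_\infty}{(z_r;q^{h_r})_\infty} \sum_{j=0}^\infty \frac{(b;q^t)_j}{(q^t;q^t)_j}\prod_{r=1}^m\frac{(z_r;q^{h_r})_{tj}}{(a_rz_r;q^{h_r})_{tj}}\,w^j . \]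
   Context: For complex $x$, $q^x$ denotes $\exp(x\log q)$ for a fixed choice of $\log q$. For a base $p$ with $|p|<1$: $(A;p)_\infty=\prod_{r=0}^\infty(1-Ap^r)$, and for any complex number $k$, $(A;p)_k := (A;p)_\infty/(Ap^k;p)_\infty$ (with powers of $p=q^x$ computed as $p^k=q^{xk}$); for nonnegative integers $k$ this equals $(1-A)(1-Ap)\cdots(1-Ap^{k-1})$, with $(A;p)_0=1$. *)

(* Defs.v *)
From HB Require Import structures.
From mathcomp Require Import all_boot all_order all_algebra finmap.
From mathcomp Require Import all_classical all_reals all_analysis.
From mathcomp Require Import complex.
From mathcomp Require Export showcase.summability.

Set Implicit Arguments.
Unset Strict Implicit.
Unset Printing Implicit Defensive.

Import Order.TTheory GRing.Theory Num.Theory.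
Import numFieldNormedType.Exports.

Local Open Scope classical_set_scope.
Local Open Scope ring_scope.
Local Open Scope complex_scope.

(* The topology of R[i] is the one given by the modulus. *)
HB.instance Definition _ (R : realType) := NormedModule.copy R[i] R[i]^o.

Section QSymbols.
Variable R : realType.
Implicit Types A p logq x k : R[i].

Definition cexp x : R[i] :=
  let: u +i* v := x in (expR u * cos v) +i* (expR u * sin v).

(* q^x, for the chosen logarithm logq of q. *)
Definition qpow logq x : R[i] := cexp (x * logq).

(* (A; p)_n for n a natural number, as a finite product; unlike the quotient
   below it makes sense for every A, including A = p^-r. *)
Definition qpoch A p (n : nat) : R[i] := \prod_(0 <= i < n) (1 - A * p ^+ i).

(* (A; p)_oo *)
Definition qpoch_inf A p : R[i] := limn (qpoch A p).

(* (A; q^x)_k for complex k. As 0^-1 = 0 here, qpochC logq A x k != 0 says that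
   both (A; q^x)_oo and the denominator (A q^(xk); q^x)_oo are nonzero. *)
Definition qpochC logq A x k : R[i] :=
  qpoch_inf A (qpow logq x) /
  qpoch_inf (A * qpow logq (x * k)) (qpow logq x).

End QSymbols.

(* Main.v *)
(* With p = q^t and X_k = q^(t (h_1 k_1 + ... + h_m k_m)), the quotient
   (w; p)_W / (b w; p)_W at W = h_1 k_1 + ... + h_m k_m is the constant
   (w; p)_oo / (b w; p)_oo times (b w X_k; p)_oo / (w X_k; p)_oo, which the
   q-binomial theorem expands as sum_j (b; p)_j / (p; p)_j w^j X_k^j. For fixed
   j the sum over k factors into m one-dimensional q-binomial series in
   z_r q^(t h_r j), whose values are the products on the right-hand side. The
   sums over j and k are exchanged by absolute convergence: q-binomial
   coefficients are bounded and |X_k| <= 1, so the double family is dominated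
   by a product of geometric sequences.
   The q-binomial theorem itself comes from the functional equation
   (1 - z) f(z) = (1 - a z) f(p z), iterated along z, p z, p^2 z, ... *)
Require Import Defs.
From mathcomp Require Import all_boot all_order all_algebra finmap.
From mathcomp Require Import all_classical all_reals all_analysis.
From mathcomp Require Import complex ring lra.
Import Order.TTheory GRing.Theory Num.Theory.
Import numFieldNormedType.Exports.
Import ComplexField.Normc.

Set Implicit Arguments.
Unset Strict Implicit.
Unset Printing Implicit Defensive.

Local Open Scope classical_set_scope.
Local Open Scope ring_scope.
Local Open Scope complex_scope.

(** * Modulus, limits and geometric domination in the complex field *)

Section ComplexModulus.
Variable R : realType.
Implicit Types (x y l : R[i]) (e : R).

Lemma normr_normc x : `|x| = (normc x)%:C.
Proof. by rewrite normc_def; case: x. Qed.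

Lemma normc_ge0 x : 0 <= normc x.
Proof. by case: x => u v; exact: sqrtr_ge0. Qed.

Lemma normc_lt1 x : `|x| < 1 -> normc x < 1.
Proof. by rewrite normr_normc -[1]/(1%:C) ltcR. Qed.

Lemma ler_normcD x y : normc (x + y) <= normc x + normc y.
Proof. by rewrite -lecR rmorphD/= -!normr_normc ler_normD. Qed.

Lemma normc_opp x : normc (- x) = normc x.
Proof. by apply/complexI; rewrite -!normr_normc normrN. Qed.

Lemma normc_sub x y : normc (x - y) = normc (y - x).
Proof. by rewrite -normc_opp opprB. Qed.

Lemma ler_normcB x y : normc (x - y) <= normc x + normc y.
Proof. by rewrite -(normc_opp y) ler_normcD. Qed.

Lemma ler_normc_subl x y : normc x - normc y <= normc (x - y).
Proof. by rewrite lerBlDr -{1}(subrK y x) ler_normcD. Qed.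

Lemma normcX x n : normc (x ^+ n) = normc x ^+ n.
Proof. by elim: n => [|n IH]; rewrite ?expr0 ?normc1// !exprS normcM IH. Qed.

Lemma normcM_lt1 x y : normc x <= 1 -> normc y < 1 -> normc (x * y) < 1.
Proof.
move=> x1 y1; rewrite normcM; apply: le_lt_trans y1.
by rewrite ler_piMl ?normc_ge0.
Qed.

Lemma normcX_le1 x n : normc x <= 1 -> normc (x ^+ n) <= 1.
Proof. by move=> x1; rewrite normcX exprn_ile1 ?normc_ge0. Qed.

Lemma normc_eq0 x : (normc x == 0) = (x == 0).
Proof.
by apply/eqP/eqP => [/eq0_normc//|->]; rewrite normc0.
Qed.

Lemma ler_normc_sum (I : Type) (r : seq I) (P : pred I) (f : I -> R[i]) :
  normc (\sum_(i <- r | P i) f i) <= \sum_(i <- r | P i) normc (f i).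
Proof.
elim/big_rec2 : _ => [|i y x _ xy]; first by rewrite normc0.
by rewrite (le_trans (ler_normcD _ _))// lerD2l.
Qed.

Lemma normc_prod (I : Type) (r : seq I) (P : pred I) (f : I -> R[i]) :
  normc (\prod_(i <- r | P i) f i) = \prod_(i <- r | P i) normc (f i).
Proof.
by elim/big_rec2 : _ => [|i y x _ xy]; rewrite ?normc1// normcM xy.
Qed.

Lemma normr_Re_le x : `|complex.Re x| <= normc x.
Proof. by rewrite -lecR -normr_normc normc_ge_Re. Qed.

Lemma normr_Im_le x : `|complex.Im x| <= normc x.
Proof.
case: x => u v /=.
by rewrite -[leLHS](sqrtr_sqr v) ler_wsqrtr// lerDr sqr_ge0.
Qed.

Lemma normc_le_ReIm x : normc x <= `|complex.Re x| + `|complex.Im x|.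
Proof.
case: x => u v /=; rewrite -[leRHS]ger0_norm ?addr_ge0//.
rewrite -sqrtr_sqr ler_wsqrtr// sqrrD !real_normK ?num_real//.
by rewrite lerD2r lerDl mulrn_wge0// mulr_ge0.
Qed.

(** The library norm on [R[i]] takes values in [R[i]], so its epsilons are complex; a positive one
    is real, hence real epsilons and the real-valued [normc] suffice. *)
Lemma cvgcP {T : Type} {F : set_system T} {FF : Filter F} (f : T -> R[i])
    (l : R[i]) :
  f @ F --> l <-> forall e : R, 0 < e -> \forall x \near F, normc (f x - l) < e.
Proof.
split=> [/cvgrPdistC_lt fl e e0|fl].
  have := fl e%:C; rewrite ltcR => /(_ e0); apply: filterS => x.
  by rewrite normr_normc ltcR.
apply/cvgrPdistC_lt => e e0.
have eE : e = (complex.Re e)%:C by rewrite RRe_real// gtr0_real.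
move: e0; rewrite eE ltcR => /fl; apply: filterS => x.
by rewrite normr_normc ltcR.
Qed.

Lemma normc_cvg_le {T : Type} {F : set_system T} {FF : ProperFilter F}
    (f : T -> R[i]) (l c : R[i]) (M : R) :
  f @ F --> l -> (\forall x \near F, normc (f x - c) <= M) ->
  normc (l - c) <= M.
Proof.
move=> /cvgcP fl fM; apply/ler_addgt0Pr => e e0.
have [x []] := filter_ex (filterI (fl e e0) fM).
rewrite normc_sub => xe xM.
rewrite (_ : l - c = (l - f x) + (f x - c)); last by ring.
by rewrite (le_trans (ler_normcD _ _))// addrC lerD// ltW.
Qed.

Lemma normc_cvg_ge {T : Type} {F : set_system T} {FF : ProperFilter F}
    (f : T -> R[i]) (l : R[i]) (M : R) :
  f @ F --> l -> (\forall x \near F, M <= normc (f x)) -> M <= normc l.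
Proof.
move=> /cvgcP fl fM; apply/ler_addgt0Pr => e e0.
have [x []] := filter_ex (filterI (fl e e0) fM).
move=> xe xM; rewrite (le_trans xM)//.
rewrite (_ : f x = l + (f x - l)); last by ring.
by rewrite (le_trans (ler_normcD _ _))// lerD2l ltW.
Qed.

(** The telescoping series of [u] converges absolutely by comparison with a geometric series. *)
Lemma cvgr_geometric_increments (u : nat -> R) (K rho : R) :
  0 <= rho -> rho < 1 -> (forall n, `|u n.+1 - u n| <= K * rho ^+ n) ->
  cvgn u.
Proof.
move=> rho0 rho1 uK.
have : cvgn (series (telescope u)).
  apply: normed_cvg; apply: (@series_le_cvg _ _ (geometric K rho)) => //=.
  - by move=> n; rewrite (le_trans _ (uK n)).
  - by apply: is_cvg_geometric_series; rewrite ger0_norm.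
rewrite telescopeK => /cvg_ex[l ul]; apply/cvg_ex; exists (l + u 0%N).
have uE n : u n = (u n - u 0%N) + u 0%N by rewrite subrK.
by rewrite (eq_cvg _ _ uE); apply: cvgD => //; exact: cvg_cst.
Qed.

(** Real and imaginary parts inherit the bound on increments, which reduces the claim to the real
    case. *)
Lemma cvgc_geometric_increments (u : nat -> R[i]) (K rho : R) :
  0 <= rho -> rho < 1 -> (forall n, normc (u n.+1 - u n) <= K * rho ^+ n) ->
  cvgn u.
Proof.
move=> rho0 rho1 uK.
have /cvg_ex[a /cvgrPdistC_lt/= ua] : cvgn (fun n => complex.Re (u n)).
  apply: (cvgr_geometric_increments rho0 rho1) => n.
  apply: le_trans (uK n); apply: le_trans (normr_Re_le _).
  by case: (u n.+1) => ? ?; case: (u n).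
have /cvg_ex[b /cvgrPdistC_lt/= ub] : cvgn (fun n => complex.Im (u n)).
  apply: (cvgr_geometric_increments rho0 rho1) => n.
  apply: le_trans (uK n); apply: le_trans (normr_Im_le _).
  by case: (u n.+1) => ? ?; case: (u n).
apply/cvg_ex; exists (a +i* b); apply/cvgcP => e e0.
have e20 : 0 < e / 2 by rewrite divr_gt0.
near=> n; rewrite (le_lt_trans (normc_le_ReIm _))//.
rewrite [e](splitr e) ltrD//.
- have : `|complex.Re (u n) - a| < e / 2 by near: n; exact: ua.
  by case: (u n).
- have : `|complex.Im (u n) - b| < e / 2 by near: n; exact: ub.
  by case: (u n).
Unshelve. all: by end_near. Qed.

Lemma sum_geometric_le (K rho : R) m n : 0 <= K -> 0 <= rho -> rho < 1 ->
  \sum_(m <= i < n) K * rho ^+ i <= K * rho ^+ m / (1 - rho).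
Proof.
move=> K0 rho0 rho1.
have d0 : 0 < 1 - rho by rewrite subr_gt0.
have [mn|nm] := leqP m n; last first.
  by rewrite big_geq 1?ltnW// divr_ge0 ?mulr_ge0 ?exprn_ge0// ltW.
rewrite ler_pdivlMr// -mulr_sumr -mulrA ler_wpM2l//.
suff -> : (\sum_(m <= i < n) rho ^+ i) * (1 - rho) = rho ^+ m - rho ^+ n.
  by rewrite gerBl exprn_ge0.
rewrite mulr_suml (@telescope_sumr_eq _ _ _ (fun k => - rho ^+ k))//.
  by rewrite opprK addrC.
by move=> k _; rewrite exprS; ring.
Qed.

Lemma cvgc_geometric_seq0 (f : nat -> R[i]) (K rho : R) :
  0 <= rho -> rho < 1 -> (forall n, normc (f n) <= K * rho ^+ n) ->
  f @ \oo --> (0 : R[i]).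
Proof.
move=> rho0 rho1 fK; apply/cvgcP => e e0.
have : geometric K rho @ \oo --> (0 : R).
  by apply: cvg_geometric; rewrite ger0_norm.
move=> /cvgrPdistC_lt /(_ e e0); apply: filterS => n /=.
by rewrite !subr0; apply: le_lt_trans; rewrite (le_trans (fK n))// ler_norm.
Qed.

Lemma cvgc_geometric_series (f : nat -> R[i]) (K rho : R) :
  0 <= rho -> rho < 1 -> (forall n, normc (f n) <= K * rho ^+ n) ->
  cvgn (series f).
Proof.
move=> rho0 rho1 fK; apply: (cvgc_geometric_increments rho0 rho1) => n.
by rewrite seriesSr addrC addKr.
Qed.

(** The bound of [sum_geometric_le] does not depend on the upper index, so it survives the passage
    to the limit. *)
Lemma geometric_series_tail (f : nat -> R[i]) (l : R[i]) (K rho : R) N :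
  0 <= rho -> rho < 1 -> (forall n, normc (f n) <= K * rho ^+ n) ->
  series f @ \oo --> l -> normc (l - series f N) <= K * rho ^+ N / (1 - rho).
Proof.
move=> rho0 rho1 fK fl; apply: (normc_cvg_le fl).
have K0 : 0 <= K.
  by have := fK 0%N; rewrite expr0 mulr1; apply: le_trans; exact: normc_ge0.
near=> n; rewrite sub_series_geq; last by near: n; exists N.
rewrite (le_trans (ler_normc_sum _ _ _))//.
by apply: le_trans (sum_geometric_le _ _ K0 rho0 rho1); exact: ler_sum.
Unshelve. all: by end_near. Qed.

End ComplexModulus.

(** * q-Pochhammer symbols and the q-binomial theorem *)

Section QBinomial.
Variable R : realType.
Implicit Types (A a p z : R[i]).

Lemma qpochS A p n : qpoch A p n.+1 = qpoch A p n * (1 - A * p ^+ n).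
Proof. by rewrite /qpoch big_nat_recr. Qed.

(** Each factor is at most 1 + |A| |p|^i <= exp(|A| |p|^i), and the exponents sum geometrically,
    uniformly in [n]. *)
Lemma normc_qpoch_le A p n : normc p < 1 ->
  normc (qpoch A p n) <= expR (normc A / (1 - normc p)).
Proof.
move=> p1; rewrite /qpoch normc_prod.
apply: (@le_trans _ _ (\prod_(0 <= i < n) expR (normc A * normc p ^+ i))).
  apply: ler_prod => i _; rewrite normc_ge0/=.
  apply: le_trans (expR_ge1Dx _); apply: le_trans (ler_normcB _ _) _.
  by rewrite normc1 normcM normcX.
rewrite -expR_sum ler_expR.
apply: le_trans (sum_geometric_le _ _ (normc_ge0 _) (normc_ge0 _) p1) _.
by rewrite expr0 mulr1.
Qed.

(** Taking inverses, 1 / (1 - u) <= 1 + u / (1 - x) <= exp(u / (1 - x)). With denominators cleared,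
    the first inequality reads 0 <= u (x - u). *)
Lemma expRN_div_le (u x : R) : 0 <= u -> u <= x -> x < 1 ->
  expR (- (u / (1 - x))) <= 1 - u.
Proof.
move=> u0 ux x1; rewrite expRN.
have x0 : 0 < 1 - x by rewrite subr_gt0.
have v0 : 0 <= u / (1 - x) by rewrite divr_ge0// ltW.
have u1 : 0 < 1 - u by rewrite subr_gt0 (le_lt_trans ux).
rewrite -[leRHS]invrK lef_pV2 ?posrE ?expR_gt0 ?invr_gt0//.
apply: le_trans (expR_ge1Dx _).
rewrite -[leLHS]mul1r ler_pdivrMr//.
rewrite -(ler_pM2r x0) mulrAC mulrDl mul1r divfK ?gt_eqF//.
by have := mulr_ge0 u0 (_ : 0 <= x - u); rewrite subr_ge0 => /(_ ux); nra.
Qed.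

(** [expRN_div_le] applies to each factor with u = |A| |p|^i and x = |A|. The lower bound is
    positive and uniform in [n], so the infinite product is nonzero too. *)
Lemma normc_qpoch_ge A p n : normc A < 1 -> normc p < 1 ->
  expR (- (normc A / (1 - normc A) / (1 - normc p))) <= normc (qpoch A p n).
Proof.
move=> A1 p1; rewrite /qpoch normc_prod.
have A0 : 0 <= normc A / (1 - normc A).
  by rewrite divr_ge0 ?normc_ge0// subr_ge0 ltW.
apply: (@le_trans _ _ (\prod_(0 <= i < n)
    expR (- (normc A / (1 - normc A) * normc p ^+ i)))).
  rewrite -expR_sum ler_expR sumrN lerN2.
  apply: le_trans (sum_geometric_le _ _ A0 (normc_ge0 _) p1) _.
  by rewrite expr0 mulr1.
apply: ler_prod => i _; rewrite expR_ge0/=.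
apply: le_trans (ler_normc_subl _ _); rewrite normc1 normcM normcX mulrAC.
apply: expRN_div_le => //; first by rewrite mulr_ge0 ?exprn_ge0 ?normc_ge0.
by rewrite ler_piMr ?normc_ge0// exprn_ile1 ?normc_ge0 ?(ltW p1).
Qed.

Lemma cvg_qpoch A p : normc p < 1 -> qpoch A p @ \oo --> qpoch_inf A p.
Proof.
move=> p1; apply: (cvgc_geometric_increments (normc_ge0 p) p1
  (K := expR (normc A / (1 - normc p)) * normc A)) => n.
rewrite qpochS (_ : _ - _ = - (qpoch A p n * A * p ^+ n)); last by ring.
rewrite normc_opp !normcM normcX.
by rewrite !ler_wpM2r ?exprn_ge0 ?normc_ge0// normc_qpoch_le.
Qed.

Lemma qpoch_neq0 A p n : normc A < 1 -> normc p < 1 -> qpoch A p n != 0.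
Proof.
move=> A1 p1; rewrite -normc_eq0 gt_eqF//.
exact: lt_le_trans (expR_gt0 _) (normc_qpoch_ge n A1 p1).
Qed.

Lemma qpoch_inf_neq0 A p : normc A < 1 -> normc p < 1 -> qpoch_inf A p != 0.
Proof.
move=> A1 p1; rewrite -normc_eq0 gt_eqF//.
apply: (lt_le_trans (expR_gt0 (- (normc A / (1 - normc A) / (1 - normc p))))).
apply: (normc_cvg_ge (cvg_qpoch p1)).
by apply: nearW => n; exact: normc_qpoch_ge.
Qed.

Definition qbin_coef a p n := qpoch a p n / qpoch p p n.

Lemma qbin_coef0 a p : qbin_coef a p 0 = 1.
Proof. by rewrite /qbin_coef /qpoch !big_nil divr1. Qed.

Lemma qbin_coefS a p n : normc p < 1 ->
  qbin_coef a p n.+1 * (1 - p ^+ n.+1) = qbin_coef a p n * (1 - a * p ^+ n).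
Proof.
move=> p1; have := qpoch_neq0 n.+1 p1 p1; rewrite /qbin_coef !qpochS -exprS.
by rewrite mulf_eq0 negb_or => /andP[? ?]; field; apply/andP.
Qed.

(** The numerator is bounded above by [normc_qpoch_le], the denominator away from 0 by
    [normc_qpoch_ge]. *)
Lemma qbin_coef_bounded a p : normc p < 1 ->
  exists2 K : R, 0 <= K & forall n, normc (qbin_coef a p n) <= K.
Proof.
move=> p1.
exists (expR (normc a / (1 - normc p)) /
        expR (- (normc p / (1 - normc p) / (1 - normc p)))) => [|n].
  by rewrite divr_ge0 ?expR_ge0.
rewrite /qbin_coef normcM normcV ler_pM ?invr_ge0 ?normc_ge0 ?normc_qpoch_le//.
rewrite lef_pV2 ?posrE ?expR_gt0 ?normc_qpoch_ge//.
exact: lt_le_trans (expR_gt0 _) (normc_qpoch_ge n p1 p1).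
Qed.

Definition qbin_term a p z n := qbin_coef a p n * z ^+ n.

Lemma normc_qbin_term a p z n (K : R) : normc (qbin_coef a p n) <= K ->
  normc (qbin_term a p z n) <= K * normc z ^+ n.
Proof.
by move=> cK; rewrite normcM normcX ler_wpM2r ?exprn_ge0 ?normc_ge0.
Qed.

(* The defect in the functional equation (1 - z) f(z) = (1 - a z) f(p z) of
   f(z) = sum_n (a; p)_n / (p; p)_n z^n when the series is truncated. *)
Lemma qbin_partial_funeq a p z n : normc p < 1 ->
  (1 - z) * series (qbin_term a p z) n -
  (1 - a * z) * series (qbin_term a p (p * z)) n =
  - (qbin_term a p z n * (1 - p ^+ n)).
Proof.
move=> p1; elim: n => [|n IH].
  by rewrite !seriesEnat/= !big_nil expr0 subrr !mulr0 subr0 oppr0.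
rewrite !seriesSr [(1 - z) * _]mulrDr [(1 - a * z) * _]mulrDr opprD addrACA IH.
rewrite /qbin_term [X in _ = - X]mulrAC (qbin_coefS a n p1) exprMn exprS.
by ring.
Qed.

Lemma is_cvg_qbinomial a p z : normc p < 1 -> normc z < 1 ->
  cvgn (series (qbin_term a p z)).
Proof.
move=> p1 z1; have [K _ cK] := qbin_coef_bounded a p1.
apply: (cvgc_geometric_series (normc_ge0 z) z1 (K := K)) => n.
exact: normc_qbin_term.
Qed.

(** The truncation defect given by [qbin_partial_funeq] is O(|z|^n) and vanishes in the limit. *)
Lemma qbinomial_funeq a p z : normc p < 1 -> normc z < 1 ->
  (1 - z) * limn (series (qbin_term a p z)) =
  (1 - a * z) * limn (series (qbin_term a p (p * z))).
Proof.
move=> p1 z1; apply/eqP; rewrite -subr_eq0; apply/eqP.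
have pz1 : normc (p * z) < 1 by rewrite normcM_lt1// ltW.
have [K _ cK] := qbin_coef_bounded a p1.
pose D n : R[i] := (1 - z) * series (qbin_term a p z) n -
  (1 - a * z) * series (qbin_term a p (p * z)) n.
have D1 : D @ \oo --> (1 - z) * limn (series (qbin_term a p z)) -
    (1 - a * z) * limn (series (qbin_term a p (p * z))).
  apply: cvgB; apply: cvgM; [exact: cvg_cst| |exact: cvg_cst|];
    exact: is_cvg_qbinomial.
have D0 : D @ \oo --> (0 : R[i]).
  (* The 2 bounds |1 - p^n|. *)
  apply: (cvgc_geometric_seq0 (normc_ge0 z) z1 (K := K * 2)) => n.
  rewrite /D qbin_partial_funeq// normc_opp normcM mulrAC ler_pM ?normc_ge0//.
    exact: normc_qbin_term.
  rewrite (le_trans (ler_normcB _ _))// normc1 -[leRHS]/(1 + 1) lerD2l.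
  by rewrite normcX_le1// ltW.
by rewrite -(cvg_lim _ D1)//; exact: cvg_lim.
Qed.

Lemma qbinomial_iter a p z n : normc p < 1 -> normc z < 1 ->
  qpoch z p n * limn (series (qbin_term a p z)) =
  qpoch (a * z) p n * limn (series (qbin_term a p (p ^+ n * z))).
Proof.
move=> p1 z1; elim: n => [|n IH].
  by rewrite /qpoch !big_nil expr0 !mul1r.
rewrite !qpochS mulrAC IH mulrAC -!mulrA; congr (_ * _).
rewrite [z * _]mulrC qbinomial_funeq//; last first.
  by rewrite normcM_lt1// normcX_le1// ltW.
by rewrite [p * (p ^+ n * z)]mulrA -exprS; congr (_ * _); ring.
Qed.

(** The constant term of the series is 1; the remaining terms, at argument p^n z, add up to
    O(|p|^n). *)
Lemma qbinomial_cvg1 a p z : normc p < 1 -> normc z < 1 ->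
  (fun n => limn (series (qbin_term a p (p ^+ n * z)))) @ \oo --> (1 : R[i]).
Proof.
move=> p1 z1; have [K K0 cK] := qbin_coef_bounded a p1.
rewrite -[1]add0r.
have fE n : limn (series (qbin_term a p (p ^+ n * z))) =
    (limn (series (qbin_term a p (p ^+ n * z))) - 1) + 1 by rewrite subrK.
rewrite (eq_cvg _ _ fE); apply: cvgD; last exact: cvg_cst.
apply: (cvgc_geometric_seq0 (normc_ge0 p) p1 (K := K / (1 - normc z))) => n.
have nz1 : normc (p ^+ n * z) < 1 by rewrite normcM_lt1// normcX_le1// ltW.
have S1 : series (qbin_term a p (p ^+ n * z)) 1 = 1.
  by rewrite seriesEnat/= big_nat1 /qbin_term qbin_coef0 expr0 mulr1.
rewrite -S1.
(* The tail from index 1 is at most K |p^n z| / (1 - |p^n z|), and |p^n z| <= |z| makes the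
   denominator uniform in [n]. *)
have := geometric_series_tail 1 (normc_ge0 _) nz1
  (fun k => normc_qbin_term _ (cK k)) (is_cvg_qbinomial p1 nz1).
move/le_trans; apply; rewrite expr1 normcM normcX.
have z0 : 0 < 1 - normc z by rewrite subr_gt0.
have pn : 0 <= normc p ^+ n by rewrite exprn_ge0 ?normc_ge0.
have pnz : normc p ^+ n * normc z <= normc z.
  by rewrite ler_piMl ?normc_ge0// exprn_ile1 ?normc_ge0// ltW.
rewrite -mulrA [leRHS]mulrAC -[leRHS]mulrA ler_wpM2l//.
rewrite ler_pM ?mulr_ge0 ?normc_ge0 ?invr_ge0//.
- by rewrite subr_ge0 (le_trans pnz)// ltW.
- by rewrite ler_piMr// ltW.
- by rewrite lef_pV2 ?posrE ?lerD2l ?lerN2// subr_gt0 (le_lt_trans pnz).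
Qed.

(** Both sides of [qbinomial_iter] are limits of one sequence as n grows; the series at p^n z tends
    to 1. *)
Theorem qbinomial a p z : normc p < 1 -> normc z < 1 ->
  limn (series (qbin_term a p z)) = qpoch_inf (a * z) p / qpoch_inf z p.
Proof.
move=> p1 z1; apply/(canRL (mulfK (qpoch_inf_neq0 z1 p1))).
rewrite mulrC.
have L : (fun n => qpoch z p n * limn (series (qbin_term a p z))) @ \oo -->
    qpoch_inf z p * limn (series (qbin_term a p z)).
  by apply: cvgM; [exact: cvg_qpoch | exact: cvg_cst].
have M : (fun n => qpoch z p n * limn (series (qbin_term a p z))) @ \oo -->
    qpoch_inf (a * z) p * 1.
  under eq_cvg do rewrite qbinomial_iter//.
  by apply: cvgM; [exact: cvg_qpoch | exact: qbinomial_cvg1].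
by rewrite -(cvg_lim _ L)// (cvg_lim _ M)// mulr1.
Qed.

End QBinomial.

(** * Exponential laws for complex powers of q *)

Section ComplexPowers.
Variable R : realType.
Implicit Types (x y logq : R[i]).

Lemma cexpD x y : cexp (x + y) = cexp x * cexp y.
Proof.
case: x y => [a b] [c d]; rewrite /cexp/= expRD cosD sinD.
by congr (_ +i* _); ring.
Qed.

Lemma cexp0 : cexp (0 : R[i]) = 1.
Proof. by rewrite /cexp/= expR0 cos0 sin0 mulr1 mulr0. Qed.

Lemma cexpMn x n : cexp (x * n%:R) = cexp x ^+ n.
Proof.
elim: n => [|n IH]; first by rewrite mulr0 cexp0 expr0.
by rewrite mulrSr mulrDr mulr1 cexpD IH exprSr.
Qed.

Lemma cexp_sum (I : Type) (r : seq I) (P : pred I) (f : I -> R[i]) :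
  cexp (\sum_(i <- r | P i) f i) = \prod_(i <- r | P i) cexp (f i).
Proof. exact: (big_morph _ cexpD cexp0). Qed.

Lemma qpowMn logq x n : qpow logq (x * n%:R) = qpow logq x ^+ n.
Proof. by rewrite /qpow mulrAC cexpMn. Qed.

Lemma qpow_sum logq (I : Type) (r : seq I) (P : pred I) (f : I -> R[i]) :
  qpow logq (\sum_(i <- r | P i) f i) = \prod_(i <- r | P i) qpow logq (f i).
Proof. by rewrite /qpow mulr_suml cexp_sum. Qed.

End ComplexPowers.

(** * Finite sums over boxes of multi-indices *)

Section BoxSums.
Variable m : nat.
Implicit Types (k : {ffun 'I_m -> nat}) (A B : {fset {ffun 'I_m -> nat}}).
Local Open Scope fset_scope.

Lemma partial_sumE (I : choiceType) (V : zmodType) (x : I -> V) (D : {fset I}) :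
  partial_sum x D = \sum_(i <- D) x i.
Proof. by rewrite big_seq_fsetE. Qed.

Definition ord_ffun (N : nat) (g : {ffun 'I_m -> 'I_N}) : {ffun 'I_m -> nat} :=
  [ffun r => val (g r)].

(** Multi-indices with all coordinates below [N], encoded as an image of the finite type of
    functions into ['I_N] so that big-operator distributivity applies. *)
Definition box (N : nat) : {fset {ffun 'I_m -> nat}} :=
  [fset ord_ffun g | g : {ffun 'I_m -> 'I_N}].

Lemma ord_ffun_inj N : injective (@ord_ffun N).
Proof.
move=> g g' /ffunP gg'; apply/ffunP => r; apply: val_inj.
by have := gg' r; rewrite !ffunE.
Qed.

Lemma in_box N k : (forall r, (k r < N)%N) -> k \in box N.
Proof.
move=> kN; apply/imfsetP; exists [ffun r => Ordinal (kN r)] => //=.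
by apply/ffunP => r; rewrite !ffunE.
Qed.

(** Boxes are cofinal among finite sets: one more than the largest coordinate occurring in [A] is a
    sufficient side. *)
Lemma fsubset_box A N : exists2 M, (N <= M)%N & A `<=` box M.
Proof.
exists (N + (\max_(k <- A) \max_(r < m) k r).+1)%N; first exact: leq_addr.
apply/fsubsetP => k kA; apply: in_box => r.
rewrite addnS ltnS; apply: leq_trans (leq_addl _ _).
apply: leq_trans (leq_bigmax_seq k kA isT).
exact: leq_bigmax (fun i => k i) r.
Qed.

Lemma sum_box (S : comNzRingType) (f : 'I_m -> nat -> S) N :
  \sum_(k <- box N) \prod_(r < m) f r (k r) =
  \prod_(r < m) \sum_(0 <= i < N) f r i.
Proof.
rewrite big_imfset/=; last by move=> ? ? _ _; exact: ord_ffun_inj.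
under [RHS]eq_bigr do rewrite big_mkord.
rewrite bigA_distr_bigA/= big_enum/=.
by apply: eq_bigr => g _; apply: eq_bigr => r _; rewrite ffunE.
Qed.

Lemma big_fsetD (I : choiceType) (V : zmodType) (C D : {fset I}) (f : I -> V) :
  C `<=` D -> \sum_(i <- D) f i - \sum_(i <- C) f i = \sum_(i <- D `\` C) f i.
Proof.
move=> CD; rewrite (big_fsetID _ (mem C))/=.
have -> : [fset x in D | x \in C] = C.
  by apply/fsetP => x; rewrite !inE/= andb_idl//; exact: (fsubsetP CD).
have -> : [fset x in D | x \notin C] = D `\` C.
  by apply/fsetP => x; rewrite !inE/= andbC.
by rewrite addrAC subrr add0r.
Qed.

Lemma sum_fsubset_le (R : numDomainType) (I : choiceType) (C D : {fset I})
    (f : I -> R) :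
  C `<=` D -> (forall i, 0 <= f i) -> \sum_(i <- C) f i <= \sum_(i <- D) f i.
Proof.
by move=> CD f0; rewrite -subr_ge0 big_fsetD// sumr_ge0.
Qed.

End BoxSums.

#[local] Existing Instance summability.totally_filter.

(** * Products of one-dimensional series as unordered multiple sums *)

Section ProductOfSeries.
Variables (R : realType) (m : nat) (K rho : 'I_m -> R).
Hypotheses (K0 : forall r, 0 <= K r) (rho0 : forall r, 0 <= rho r).
Hypothesis rho1 : forall r, rho r < 1.

Let g r n := K r * rho r ^+ n.
Let g0 r n : 0 <= g r n.
Proof. by rewrite mulr_ge0 ?exprn_ge0. Qed.

Let Q := \prod_(r < m) (K r / (1 - rho r)).

Lemma sum_prod_geometric_le (A : {fset {ffun 'I_m -> nat}}) :
  \sum_(k <- A) \prod_(r < m) (K r * rho r ^+ k r) <=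
  \prod_(r < m) (K r / (1 - rho r)).
Proof.
have [N _ AN] := fsubset_box A 0.
apply: (@le_trans _ _ (\sum_(k <- box m N) \prod_(r < m) g r (k r))).
  by apply: sum_fsubset_le => // k; apply: prodr_ge0 => r _; exact: g0.
rewrite sum_box; apply: ler_prod => r _; rewrite sumr_ge0//=.
apply: le_trans (sum_geometric_le _ _ (K0 r) (rho0 r) (rho1 r)) _.
by rewrite expr0 mulr1.
Qed.

Lemma prod_geometric_cvg :
  (fun N => \prod_(r < m) \sum_(0 <= i < N) (K r * rho r ^+ i)) @ \oo --> Q.
Proof.
apply: cvg_big; first exact: mul_continuous.
move=> r _; have : `|rho r| < 1 by rewrite ger0_norm.
move=> /(@cvg_geometric_series _ (K r)).
by rewrite seriesEnat.
Qed.

(** Over a box the sum is a product of partial sums, which converges. Enlarging the box to any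
    finite set changes the sum by at most the mass of the geometric majorant outside the box. *)
Lemma cvg_sum_prod_series (f : 'I_m -> nat -> R[i]) (s : 'I_m -> R[i]) :
  (forall r n, normc (f r n) <= K r * rho r ^+ n) ->
  (forall r, series (f r) @ \oo --> s r) ->
  partial_sum (fun k : {ffun 'I_m -> nat} => \prod_(r < m) f r (k r)) @ totally
    --> \prod_(r < m) s r.
Proof.
move=> fK fs.
have sN : (fun N => \prod_(r < m) series (f r) N) @ \oo --> \prod_(r < m) s r.
  by apply: cvg_big => //; exact: mul_continuous.
apply/cvgcP => e e0; have e20 : 0 < e / 2 by rewrite divr_gt0.
(* A single [N] puts the box sum of the majorant within e/2 of its total [Q], and the product of
   partial sums within e/2 of its limit. *)
have [N [QN PN]] := filter_ex (filterI
  ((cvgrPdist_lt _ _).1 prod_geometric_cvg _ e20) ((cvgcP _ _).1 sN _ e20)).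
exists (box m N) => // A /= NA; rewrite partial_sumE.
rewrite (_ : _ - _ = (\sum_(k <- A) \prod_(r < m) f r (k r) -
  \sum_(k <- box m N) \prod_(r < m) f r (k r)) +
  (\prod_(r < m) series (f r) N - \prod_(r < m) s r)); last first.
  by rewrite sum_box; ring.
rewrite (le_lt_trans (ler_normcD _ _))// [e]splitr ltrD//.
apply: le_lt_trans QN; rewrite big_fsetD//.
apply: le_trans (ler_normc_sum _ _ _) _; apply: le_trans (ler_norm _).
apply: (@le_trans _ _
  (\sum_(k <- (A `\` box m N)%fset) \prod_(r < m) g r (k r))).
  apply: ler_sum => k _; rewrite normc_prod; apply: ler_prod => r _.
  by rewrite normc_ge0 fK.
by rewrite -big_fsetD// sum_box lerD2r sum_prod_geometric_le.
Qed.

End ProductOfSeries.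

(** * Exchange of an unordered sum with a dominated series *)

Section Exchange.
Variables (R : realType) (I : choiceType) (f : nat -> I -> R[i]).
Variables (H : nat -> R[i]) (D : I -> R) (K rho Q : R).
Hypotheses (rho0 : 0 <= rho) (rho1 : rho < 1) (K0 : 0 <= K).
Hypothesis f_le : forall j k, normc (f j k) <= K * D k * rho ^+ j.
Hypothesis D_le : forall A : {fset I}, \sum_(k <- A) D k <= Q.
Hypothesis f_cvg : forall j, partial_sum (f j) @ totally --> H j.

Lemma normc_row_sum_le j : normc (H j) <= K * Q * rho ^+ j.
Proof.
rewrite -[H j]subr0; apply: (normc_cvg_le (@f_cvg j)).
apply: nearW => A; rewrite subr0 partial_sumE.
apply: le_trans (ler_normc_sum _ _ _) _.
apply: (@le_trans _ _ (\sum_(k <- A) K * D k * rho ^+ j)).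
  by apply: ler_sum => k _; exact: f_le.
by rewrite -mulr_suml -mulr_sumr ler_wpM2r ?exprn_ge0// ler_wpM2l.
Qed.

Lemma is_cvg_row_sums : cvgn (series H).
Proof. exact: cvgc_geometric_series rho0 rho1 normc_row_sum_le. Qed.

Lemma is_cvg_column k : cvgn (series (f^~ k)).
Proof. by apply: (cvgc_geometric_series rho0 rho1) => j; exact: f_le. Qed.

(** Cutting at an index [J] leaves finitely many rows, whose finite sum converges. The discarded
    parts of the columns over any finite set, and of the series of row sums, obey the same bound K Q
    rho^J / (1 - rho). *)
Lemma cvg_sum_series_exchange :
  partial_sum (fun k => limn (series (f^~ k))) @ totally --> limn (series H).
Proof.
apply/cvgcP => e e0; have e30 : 0 < e / 3 by rewrite divr_gt0.
have [J TJ] : exists J, K * Q * rho ^+ J / (1 - rho) < e / 3.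
  have : geometric (K * Q / (1 - rho)) rho @ \oo --> (0 : R).
    by apply: cvg_geometric; rewrite ger0_norm.
  move=> /cvgrPdistC_lt/(_ _ e30)/filter_ex[J].
  rewrite subr0 /geometric/= => JT.
  by exists J; rewrite mulrAC (le_lt_trans (ler_norm _)).
have mid : (fun A => \sum_(0 <= j < J) partial_sum (f j) A) @ totally -->
    series H J.
  by apply: cvg_big => //; exact: add_continuous.
move/cvgcP/(_ _ e30) : mid; apply: filterS => A midA.
(* Three errors: the column tails over [A], the convergence of the first [J] rows, and the tail of
   the row sums. *)
rewrite (_ : _ - _ =
  (partial_sum (fun k => limn (series (f^~ k))) A -
   \sum_(0 <= j < J) partial_sum (f j) A) +
  (\sum_(0 <= j < J) partial_sum (f j) A - series H J) -
  (limn (series H) - series H J)); last by ring.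
apply: le_lt_trans (ler_normcB _ _) _.
have -> : e = e / 3 + e / 3 + e / 3 by field.
rewrite ltrD//; last first.
  apply: le_lt_trans TJ.
  exact: (geometric_series_tail J rho0 rho1 normc_row_sum_le is_cvg_row_sums).
apply: le_lt_trans (ler_normcD _ _) _; rewrite ltrD//.
apply: le_lt_trans TJ.
under eq_bigr do rewrite partial_sumE.
rewrite partial_sumE exchange_big/= -sumrB.
apply: le_trans (ler_normc_sum _ _ _) _.
apply: (@le_trans _ _ (\sum_(k <- A) K * D k * rho ^+ J / (1 - rho))).
  apply: ler_sum => k _.
  apply: (geometric_series_tail J rho0 rho1 (f_le^~ k)).
  exact: is_cvg_column.
rewrite -!mulr_suml -mulr_sumr ler_wpM2r ?invr_ge0 ?subr_ge0 ?(ltW rho1)//.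
by rewrite ler_wpM2r ?exprn_ge0// ler_wpM2l.
Qed.

End Exchange.

(** * Assembly of the multiple-series identity *)

Lemma cvg_seriesMr (R : realType) (u : nat -> R[i]) (l c : R[i]) :
  series u @ \oo --> l -> series (fun j => u j * c) @ \oo --> l * c.
Proof.
move=> ul.
have uE n : series (fun j => u j * c) n = series u n * c.
  by rewrite !seriesEnat/= mulr_suml.
by rewrite (eq_cvg _ _ uE); exact: (cvgM ul (cvg_cst c)).
Qed.

(** Splits a ratio of two [qpochC] values into a factor free of the summation index, x / u, and one
    that depends on it, v / y. *)
Lemma divf_div_divf (K : fieldType) (x y u v : K) :
  (x / y) / (u / v) = x / u * (v / y).
Proof. by rewrite invf_div mulrACA [RHS]mulrACA [y^-1 * _]mulrC. Qed.

Theorem theorem2 (R : realType) (m : nat) (a : 'I_m -> R[i]) (b : R[i])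
    (q logq t : R[i]) (h : 'I_m -> R[i]) (w : R[i]) (z : 'I_m -> R[i])
    (hm : (1 <= m)%N)
    (hq : cexp logq = q)
    (ht : `|qpow logq t| < 1)
    (hh : forall r, `|qpow logq (h r)| < 1)
    (hth : forall r, `|qpow logq (t * h r)| < 1)
    (hw : `|w| < 1)
    (hz : forall r, `|z r| < 1)
    (* none of the denominators vanish *)
    (hd1 : forall r (k : nat),
        qpoch (qpow logq (h r)) (qpow logq (h r)) k != 0)
    (hd2 : forall k : {ffun 'I_m -> nat},
        qpochC logq (b * w) t (\sum_(r < m) h r * (k r)%:R) != 0)
    (hd3 : qpoch_inf (b * w) (qpow logq t) != 0)
    (hd4 : forall r, qpoch_inf (z r) (qpow logq (h r)) != 0)
    (hd5 : forall j : nat, qpoch (qpow logq t) (qpow logq t) j != 0)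
    (hd6 : forall r (j : nat),
        qpochC logq (a r * z r) (h r) (t * j%:R) != 0) :
  let F (k : {ffun 'I_m -> nat}) : R[i] :=
    (\prod_(r < m) (qpoch (a r) (qpow logq (h r)) (k r) /
                    qpoch (qpow logq (h r)) (qpow logq (h r)) (k r))) *
    (qpochC logq w t (\sum_(r < m) h r * (k r)%:R) /
     qpochC logq (b * w) t (\sum_(r < m) h r * (k r)%:R)) *
    \prod_(r < m) z r ^+ k r in
  let G (j : nat) : R[i] :=
    qpoch b (qpow logq t) j / qpoch (qpow logq t) (qpow logq t) j *
    (\prod_(r < m) (qpochC logq (z r) (h r) (t * j%:R) /
                    qpochC logq (a r * z r) (h r) (t * j%:R))) *
    w ^+ j in
  [/\ cvg (partial_sum F @ totally),
      cvgn (series G) &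
      summability.sum F =
        qpoch_inf w (qpow logq t) / qpoch_inf (b * w) (qpow logq t) *
        (\prod_(r < m) (qpoch_inf (a r * z r) (qpow logq (h r)) /
                        qpoch_inf (z r) (qpow logq (h r)))) *
        limn (series G)].
Proof.
move=> F G.
pose p := qpow logq t; pose P r := qpow logq (h r).
(* [T r] links the two sides: q^(t sum h_r k_r) is the product of the (T r)^(k_r), while q^(h_r t j)
   is (T r)^j. *)
pose T r := qpow logq (t * h r).
have p1 : normc p < 1 by exact: normc_lt1.
have P1 r : normc (P r) < 1 by exact: normc_lt1 (hh r).
have T1 r : normc (T r) <= 1 by apply/ltW/normc_lt1/hth.
have w1 : normc w < 1 by exact: normc_lt1.
have z1 r : normc (z r) < 1 by exact: normc_lt1 (hz r).
have [Kb Kb0 Kb_le] := qbin_coef_bounded b p1.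
have /choice[K KP] : forall r, exists K : R,
    0 <= K /\ forall n, normc (qbin_coef (a r) (P r) n) <= K.
  by move=> r; have [K] := qbin_coef_bounded (a r) (P1 r); exists K.
have K0 r := (KP r).1; have K_le r := (KP r).2.
pose X (k : {ffun 'I_m -> nat}) : R[i] := \prod_(r < m) T r ^+ k r.
have XE (k : {ffun 'I_m -> nat}) :
    qpow logq (t * \sum_(r < m) h r * (k r)%:R) = X k.
  rewrite mulr_sumr qpow_sum; apply: eq_bigr => r _.
  by rewrite mulrA qpowMn.
have TE r j : qpow logq (h r * (t * j%:R)) = T r ^+ j.
  by rewrite mulrA [h r * t]mulrC qpowMn.
have X1 k : normc (X k) <= 1.
  rewrite normc_prod; apply: prodr_ile1 => r _.
  by rewrite normc_ge0 normcX_le1.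
pose c : R[i] := qpoch_inf w p / qpoch_inf (b * w) p.
(* [L j] is the product of the values of the one-dimensional series at z_r (T r)^j; [H j] is then
   the sum over k of the double family [f j k]. *)
pose L j : R[i] := \prod_(r < m)
  (qpoch_inf (a r * (z r * T r ^+ j)) (P r) / qpoch_inf (z r * T r ^+ j) (P r)).
pose H j : R[i] := qbin_term b p w j * L j.
pose f j (k : {ffun 'I_m -> nat}) : R[i] := qbin_term b p (w * X k) j *
  \prod_(r < m) qbin_term (a r) (P r) (z r) (k r).
pose D (k : {ffun 'I_m -> nat}) : R := \prod_(r < m) (K r * normc (z r) ^+ k r).
have f_le j k : normc (f j k) <= Kb * D k * normc w ^+ j.
  rewrite normcM mulrAC ler_pM ?normc_ge0//.
    rewrite (le_trans (normc_qbin_term _ (Kb_le j)))// ler_wpM2l//.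
    rewrite normcM lerXn2r ?nnegrE ?mulr_ge0 ?normc_ge0//.
    by rewrite ler_piMr ?normc_ge0.
  rewrite normc_prod; apply: ler_prod => r _.
  by rewrite normc_ge0 normc_qbin_term.
have f_cvg j : partial_sum (f j) @ totally --> H j.
  (* For fixed j the factor (X k)^j is distributed over the coordinates, turning each z_r into z_r
     (T r)^j. *)
  have fE A : partial_sum (f j) A = qbin_term b p w j *
      partial_sum (fun k : {ffun 'I_m -> nat} => \prod_(r < m)
        qbin_term (a r) (P r) (z r * T r ^+ j) (k r)) A.
    rewrite !partial_sumE mulr_sumr; apply: eq_bigr => k _.
    rewrite /f /qbin_term exprMn [_ * (w ^+ j * _)]mulrA -[LHS]mulrA.
    congr (_ * _).
    rewrite /X -prodrXl -big_split/=; apply: eq_bigr => r _.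
    by rewrite exprMn exprAC mulrCA [(_ ^+ j) ^+ _ * _]mulrC.
  rewrite (eq_cvg _ _ fE).
  suff cL : partial_sum (fun k : {ffun 'I_m -> nat} => \prod_(r < m)
      qbin_term (a r) (P r) (z r * T r ^+ j) (k r)) @ totally --> L j.
    exact: (cvgM (cvg_cst _) cL).
  apply: (@cvg_sum_prod_series _ _ _ _ K0 (fun r => normc_ge0 (z r)) z1
    (fun r => qbin_term (a r) (P r) (z r * T r ^+ j))) => r.
    move=> n; rewrite (le_trans (normc_qbin_term _ (K_le r n)))// ler_wpM2l//.
    rewrite normcM lerXn2r ?nnegrE ?mulr_ge0 ?normc_ge0//.
    by rewrite ler_piMr ?normc_ge0// normcX_le1.
  have zT1 : normc (z r * T r ^+ j) < 1.
    by rewrite mulrC normcM_lt1// normcX_le1.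
  by rewrite -qbinomial//; exact: is_cvg_qbinomial.
have D_le A := sum_prod_geometric_le K0 (fun r => normc_ge0 (z r)) z1 A.
have Hcvg := is_cvg_row_sums (normc_ge0 w) w1 Kb0 f_le D_le f_cvg.
have sumf := cvg_sum_series_exchange (normc_ge0 w) w1 Kb0 f_le D_le f_cvg.
(* Summing over j is the q-binomial theorem at w X_k, with value (b w X_k; p)_oo / (w X_k; p)_oo. *)
have FE k : F k = c * limn (series (f^~ k)).
  have wX1 : normc (w * X k) < 1 by rewrite mulrC normcM_lt1.
  have fk : series (f^~ k) @ \oo --> limn (series (qbin_term b p (w * X k))) *
      \prod_(r < m) qbin_term (a r) (P r) (z r) (k r).
    exact: (cvg_seriesMr (is_cvg_qbinomial p1 wX1)).
  rewrite (cvg_lim _ fk)// qbinomial//.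
  rewrite /F /qpochC XE divf_div_divf -/p -/c [b * (w * _)]mulrA.
  by rewrite /qbin_term /qbin_coef !big_split/= [X in X * _ = _]mulrC -!mulrA.
have Fcvg : partial_sum F @ totally --> c * limn (series H).
  have FA A : partial_sum F A =
      c * partial_sum (fun k => limn (series (f^~ k))) A.
    by rewrite !partial_sumE mulr_sumr; apply: eq_bigr => k _.
  by rewrite (eq_cvg _ _ FA); exact: (cvgM (cvg_cst c) sumf).
pose d : R[i] :=
  \prod_(r < m) (qpoch_inf (a r * z r) (P r) / qpoch_inf (z r) (P r)).
have d0 : d != 0.
  apply/prodf_neq0 => r _; rewrite mulf_neq0 ?invr_neq0//.
  (* At j = 0, [hd6] is a nonvanishing quotient with numerator (a_r z_r; q^(h_r))_oo, so that
     numerator is nonzero. *)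
  by have := hd6 r 0%N; rewrite mulf_eq0 negb_or => /andP[].
(* Each [qpochC] quotient in [G] is a factor of [L j] over the matching factor of [d]; the prefactor
   [d] of the right-hand side cancels this d^-1. *)
have HG : G = (fun j => H j * d^-1).
  apply/funext => j; rewrite /G.
  have -> : \prod_(r < m) (qpochC logq (z r) (h r) (t * j%:R) /
      qpochC logq (a r * z r) (h r) (t * j%:R)) = L j / d.
    rewrite /L /d -prodfV -big_split/=; apply: eq_bigr => r _.
    rewrite /qpochC TE divf_div_divf invf_div -/(P r).
    by rewrite [a r * (_ * _)]mulrA mulrC.
  by rewrite mulrAC mulrA.
have Gcvg : series G @ \oo --> limn (series H) * d^-1.
  by rewrite HG; exact: cvg_seriesMr Hcvg.
split.
- exact: cvgP Fcvg.
- exact: cvgP Gcvg.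
- rewrite /summability.sum (cvg_lim _ Fcvg)// (cvg_lim _ Gcvg)// -/p -/c -/d.
  by rewrite -mulrA; congr (_ * _); rewrite mulrCA mulfV// mulr1.
Qed.
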